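(* For $p=(p_1,p_2,p_3)\in\mathcal{H}$ let $G(p)=|p|^4=(p_1^2+p_2^2)^2+16p_3^2$. Then $$w(p,t)=(p_1^2+p_2^2)^2+12t(p_1^2+p_2^2)+16p_3^2+12t^2$$ is a continuous solution of $$u_t-\operatorname{tr}\left[\left(I-\frac{\nabla_H u\otimes\nabla_H u}{|\nabla_H u|^2}\right)(\nabla_H^2u)^\ast\right]=0\quad\text{in }\mathcal{H}\times(0,\infty),$$ and $w(p,0)=G(p)$ for all $p\in\mathcal{H}$.
   Context: The Heisenberg group $\mathcal{H}$ is $\mathbb{R}^3$ with the multiplication $(p_1,p_2,p_3)\cdot(q_1,q_2,q_3)=(p_1+q_1,\,p_2+q_2,\,p_3+q_3+\tfrac12(p_1q_2-q_1p_2))$. Set $X_1=\partial_{p_1}-\tfrac{p_2}{2}\partial_{p_3}$, $X_2=\partial_{p_2}+\tfrac{p_1}{2}\partial_{p_3}$, $\nabla_Hu=(X_1u,X_2u)$, and let $(\nabla_H^2u)^\ast$ be the symmetric $2\times2$ matrix with diagonal entries $X_1^2u$, $X_2^2u$ and off-diagonal entries $\tfrac12(X_1X_2u+X_2X_1u)$. Solutions are in the viscosity sense. For $\eta\in\mathbb{R}^2\setminus\{0\}$ and a symmetric $2\times 2$ matrix $Y$ put $F(\eta,Y)=-\operatorname{tr}\big((I-\frac{\eta\otimes\eta}{|\eta|^2})Y\big)$, and let $F_\star$ and $F^\star$ be the lower and upper semicontinuous envelopes of $F$, defined on all of $\mathbb{R}^2\times\mathbf{S}^2$, where $\mathbf{S}^2$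 is the space of symmetric $2\times2$ matrices. Let $\mathcal{O}\subset\mathcal{H}\times(0,\infty)$ be open. An upper (resp. lower) semicontinuous function $u$ on $\mathcal{O}$ is a subsolution (resp. supersolution) in $\mathcal{O}$ if (i) $u<\infty$ (resp. $u>-\infty$) in $\mathcal{O}$; and (ii) whenever $\phi$ is a smooth function on $\mathcal{O}$ and $u-\phi$ attains a (finite) maximum (resp. minimum) over $\mathcal{O}$ at $(\hat p,\hat t)$, then at $(\hat p,\hat t)$: $\phi_t+F_\star(\nabla_H\phi,(\nabla_H^2\phi)^\ast)\le0$ (resp. $\phi_t+F^\star(\nabla_H\phi,(\nabla_H^2\phi)^\ast)\ge0$). A solution is both a subsolution and a supersolution. *)

(* Defs.v *)
From HB Require Import structures.
From mathcomp Require Import all_boot all_order all_algebra.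
From mathcomp Require Import all_classical all_reals all_analysis.

Set Implicit Arguments.
Unset Strict Implicit.
Unset Printing Implicit Defensive.

Import Order.TTheory GRing.Theory Num.Theory.
Import numFieldNormedType.Exports.

Local Open Scope classical_set_scope.
Local Open Scope ring_scope.

(* The coordinates p_1, p_2, p_3 of the mathematical text are p 0 0, p 0 1 and
   p 0 2. *)
Notation heisenberg R := 'rV[R]_3.
Notation spacetime R := ('rV[R]_3 * R)%type.

(* X1 and X2 below are the left-invariant vector fields of this group law that
   equal d/dp_1 and d/dp_2 at the origin; the law enters only through them. *)
Definition heisenberg_mul (R : realType) (p q : heisenberg R) : heisenberg R :=
  p + q + (2^-1 * (p 0 0 * q 0 1 - q 0 0 * p 0 1)) *: delta_mx 0 2.

Definition space_partial (R : realType) (i : 'I_3) (u : spacetime R -> R) :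
    spacetime R -> R :=
  'D_(delta_mx 0 i, 0) u.

Definition time_partial (R : realType) (u : spacetime R -> R) :
    spacetime R -> R :=
  'D_(0, 1) u.

Definition X1 (R : realType) (u : spacetime R -> R) (z : spacetime R) : R :=
  space_partial 0 u z - z.1 0 1 / 2 * space_partial 2 u z.

Definition X2 (R : realType) (u : spacetime R -> R) (z : spacetime R) : R :=
  space_partial 1 u z + z.1 0 0 / 2 * space_partial 2 u z.

Definition horizontal_field (R : realType) (i : 'I_2) :
    (spacetime R -> R) -> spacetime R -> R :=
  if i == 0 then @X1 R else @X2 R.

Definition horizontal_gradient (R : realType) (u : spacetime R -> R)
    (z : spacetime R) : 'rV[R]_2 :=
  \row_i horizontal_field i u z.

Definition sym_horizontal_hessian (R : realType) (u : spacetime R -> R)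
    (z : spacetime R) : 'M[R]_2 :=
  \matrix_(i, j)
    (2^-1 * (horizontal_field i (horizontal_field j u) z
             + horizontal_field j (horizontal_field i u) z)).

(* Only meaningful for eta <> 0: at eta = 0 the convention 0^-1 = 0 gives a
   value that the envelopes below disregard. The norm is spelled out because
   the library norm of 'rV[R]_2 is the sup norm. *)
Definition mcf_operator (R : realType) (eta : 'rV[R]_2) (Y : 'M[R]_2) : R :=
  - \tr ((1%:M - (eta 0 0 ^+ 2 + eta 0 1 ^+ 2)^-1 *: (eta^T *m eta)) *m Y).

Definition mcf_domain (R : realType) : set ('rV[R]_2 * 'M[R]_2) :=
  [set x | x.1 != 0 /\ x.2^T = x.2].

(* The neighbourhoods are not punctured, so that on the domain the lower (resp.
   upper) limit is at most (resp. at least) the value of the operator. *)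
Definition mcf_lower_envelope (R : realType) (eta : 'rV[R]_2) (Y : 'M[R]_2) :
    \bar R :=
  limf_einf (fun x : 'rV[R]_2 * 'M[R]_2 => (mcf_operator x.1 x.2)%:E)
            (within (@mcf_domain R) (nbhs (eta, Y))).

Definition mcf_upper_envelope (R : realType) (eta : 'rV[R]_2) (Y : 'M[R]_2) :
    \bar R :=
  limf_esup (fun x : 'rV[R]_2 * 'M[R]_2 => (mcf_operator x.1 x.2)%:E)
            (within (@mcf_domain R) (nbhs (eta, Y))).

(* Here O is open and V is finite dimensional, so that continuity of the
   differential is continuity of all the directional derivatives. *)
Fixpoint Ck_on (R : realType) (V : normedModType R) (O : set V) (k : nat)
    (f : V -> R) : Prop :=
  match k with
  | 0%N => forall x, O x -> {for x, continuous f}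
  | k'.+1 => (forall x, O x -> differentiable f x) /\
             forall v : V, Ck_on O k' ('D_v f)
  end.

Definition smooth_on (R : realType) (V : normedModType R) (O : set V)
    (f : V -> R) : Prop :=
  forall k : nat, Ck_on O k f.

Definition upper_semicontinuous (X : topologicalType) (R : numFieldType)
    (f : X -> \bar R) : Prop :=
  forall x a, (f x < a%:E)%E ->
    exists2 V, nbhs x V & forall y, V y -> (f y < a%:E)%E.

(* In the next three definitions O is an open subset of H x (0, +oo); only the
   values of u and phi on O matter. *)
Definition viscosity_subsolution (R : realType) (O : set (spacetime R))
    (u : spacetime R -> \bar R) : Prop :=
  [/\ upper_semicontinuous (u : subspace O -> \bar R),
      forall z, O z -> (u z < +oo)%E
    & forall (phi : spacetime R -> R) (z : spacetime R),
        smooth_on O phi -> O z -> u z \is a fin_num ->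
        (forall y, O y -> (u y - (phi y)%:E <= u z - (phi z)%:E)%E) ->
        ((time_partial phi z)%:E
          + mcf_lower_envelope (horizontal_gradient phi z)
                               (sym_horizontal_hessian phi z) <= 0)%E].

Definition viscosity_supersolution (R : realType) (O : set (spacetime R))
    (u : spacetime R -> \bar R) : Prop :=
  [/\ lower_semicontinuous (u : subspace O -> \bar R),
      forall z, O z -> (-oo < u z)%E
    & forall (phi : spacetime R -> R) (z : spacetime R),
        smooth_on O phi -> O z -> u z \is a fin_num ->
        (forall y, O y -> (u z - (phi z)%:E <= u y - (phi y)%:E)%E) ->
        (0 <= (time_partial phi z)%:E
          + mcf_upper_envelope (horizontal_gradient phi z)
                               (sym_horizontal_hessian phi z))%E].

Definition viscosity_solution (R : realType) (O : set (spacetime R))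
    (u : spacetime R -> \bar R) : Prop :=
  viscosity_subsolution O u /\ viscosity_supersolution O u.

(* The fourth power of the homogeneous gauge |p|. *)
Definition gauge4 (R : realType) (p : heisenberg R) : R :=
  (p 0 0 ^+ 2 + p 0 1 ^+ 2) ^+ 2 + 16 * p 0 2 ^+ 2.

Definition explicit_flow (R : realType) (z : spacetime R) : R :=
  let: (p, t) := z in
  (p 0 0 ^+ 2 + p 0 1 ^+ 2) ^+ 2 + 12 * t * (p 0 0 ^+ 2 + p 0 1 ^+ 2)
  + 16 * p 0 2 ^+ 2 + 12 * t ^+ 2.

(* Main.v *)
(* Along the straight line p * exp(s (a X1 + b X2)) the second derivative of a
   function is the value at (a, b) of its symmetrized horizontal Hessian. The
   horizontal Hessian of w is (12 r^2 + 24 t) I, where r^2 = p_1^2 + p_2^2, and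
   w_t = 12 r^2 + 24 t. If phi touches w at z, the first- and second-order
   conditions along lines give phi_t = w_t and compare the Hessian of phi with
   (12 r^2 + 24 t) I as quadratic forms. Since F(eta, Y) is minus the value of Y
   at a unit vector orthogonal to eta, this bounds F(eta', Y) for every
   eta' <> 0, hence both envelopes, also where the gradient vanishes. *)
Require Import Defs.
From mathcomp Require Import all_boot all_order all_algebra.
From mathcomp Require Import all_classical all_reals all_analysis.
From mathcomp Require Import ring lra.
Import Order.TTheory GRing.Theory Num.Theory.
Import numFieldNormedType.Exports.

Local Open Scope classical_set_scope.
Local Open Scope ring_scope.

(** * First- and second-order conditions at a contact point along a line *)

(** If [l] were negative, [g] would be negative just to the right of [0], where it vanishes, and [f]
    would drop below its minimum there. Only differentiability of [g] at the single point [0]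
    enters. *)
Lemma local_min_second_order (R : realType) (f g : R -> R) (l : R) :
  (\forall s \near (0 : R), is_derive s (1 : R) f (g s)) ->
  is_derive (0 : R) (1 : R) g l ->
  (\forall s \near (0 : R), f 0 <= f s) ->
  g 0 = 0 /\ 0 <= l.
Proof.
move=> fg gl fmin.
have /nbhs_ballP[e /= e0 eP] :
    \forall s \near (0 : R), is_derive s (1 : R) f (g s) /\ f 0 <= f s.
  by near=> s; split; near: s.
have inb s : s \in `]- e, e[ -> is_derive s (1 : R) f (g s) /\ f 0 <= f s.
  by rewrite in_itv /= -ltr_norml => se; apply: eP; rewrite /ball /= sub0r normrN.
have g0 : g 0 = 0.
  have i0 : 0 \in `]- e, e[ by rewrite in_itv /= e0 oppr_lt0 e0.
  have f0 : is_derive (0 : R) (1 : R) f 0.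
    apply: (@derive1_at_min _ f (- e) e) => //.
    - by rewrite ge0_cp // ltW.
    - by move=> t /inb[[]].
    - by move=> t /inb[].
  by have [[_ <-] _] := inb _ i0; case: f0.
split=> //; rewrite leNgt; apply/negP => l0.
have gcvg : h^-1 *: ((g \o shift 0) (h *: 1) - g 0) @[h --> 0^'] --> l.
  by have := gl; move=> [+ <-].
have /nbhs_ballP[d /= d0 dP] :
    \forall h \near 0^', h^-1 *: ((g \o shift 0) (h *: 1) - g 0) < 0.
  exact: (cvgr_lt _ gcvg).
pose m := Num.min d e / 2.
have m0 : 0 < m by rewrite divr_gt0 // lt_min d0.
have [md me] : m < d /\ m < e.
  have : m < Num.min d e by rewrite /m; have : 0 < Num.min d e; [rewrite lt_min d0|lra].
  by rewrite lt_min => /andP.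
have inm s : 0 <= s <= m -> s \in `]- e, e[ by rewrite in_itv /=; lra.
(* The intermediate point satisfies [0 < c < m < d], so the quotient [g c / c] is negative, which
   contradicts [f 0 <= f m]. *)
have [c cm fE] : exists2 c, c \in `]0, m[ & f m - f 0 = g c * (m - 0).
  apply: MVT => //.
    by move=> x; rewrite in_itv /= => xm; have [] := inb x (inm x ltac:(lra)).
  apply: derivable_within_continuous => x; rewrite in_itv /= => xm.
  by have [[]] := inb x (inm x xm).
move: cm; rewrite in_itv /= => /andP[c0 cm].
have : c^-1 *: ((g \o shift 0) (c *: 1) - g 0) < 0.
  apply: dP; last by rewrite gt_eqF.
  by rewrite /ball /= sub0r normrN gtr0_norm //; lra.
rewrite /= addr0 g0 subr0 /GRing.scale /= mulr1 pmulr_rlt0 ?invr_gt0 // => gc.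
have [_ fm] := inb m (inm m ltac:(lra)).
have : g c * (m - 0) < 0 by rewrite subr0 nmulr_rlt0.
lra.
Unshelve. all: by end_near. Qed.

Lemma is_derive_line (R : realType) (V : normedModType R) (f : V -> R)
    (v z : V) (s : R) :
  derivable f (s *: v + z) v ->
  is_derive s (1 : R) (fun s => f (s *: v + z)) ('D_v f (s *: v + z)).
Proof.
have E : (fun h : R => h^-1 *: (((fun s => f (s *: v + z)) \o shift s) (h *: 1)
            - f (s *: v + z)))
       = (fun h : R => h^-1 *: ((f \o shift (s *: v + z)) (h *: v) - f (s *: v + z))).
  apply/funext => h /=; congr (_ *: (f _ - _)).
  have -> : h *: (1 : R) = h := mulr1 h.
  by rewrite scalerDl addrA.
by move=> df; split; rewrite /derivable /derive E.
Qed.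

(* The sign of [e] decides whether [p] touches [phi] from below or above. *)
Lemma line_contact (R : realType) (V : normedModType R) (O : set V)
    (phi : V -> R) (z v : V) (p : {poly R}) (e : R) :
  open O -> smooth_on O phi -> O z ->
  (forall s, O (s *: v + z) ->
     e * (phi z - p.[0]) <= e * (phi (s *: v + z) - p.[s])) ->
  e * ('D_v phi z - p^`().[0]) = 0 /\
  0 <= e * ('D_v ('D_v phi) z - p^`()^`().[0]).
Proof.
move=> oO sphi Oz contact.
have line0 : 0 *: v + z = z by rewrite scale0r add0r.
have nearO : \forall s \near (0 : R), O (s *: v + z).
  have /(_ O) : (fun s : R => s *: v + z) @ (0 : R) --> z.
    rewrite -[X in _ --> X]line0; apply: cvgD; last exact: cvg_cst.
    by apply: cvgZ; [exact: cvg_id | exact: cvg_cst].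
  by apply; exact: open_nbhs_nbhs.
have [dphi dDphi] := sphi 2.
pose f s := e * (phi (s *: v + z) - p.[s]).
pose g s := e * ('D_v phi (s *: v + z) - p^`().[s]).
have [g0 l0] : g 0 = 0 /\ 0 <= e * ('D_v ('D_v phi) z - p^`()^`().[0]).
  apply: (@local_min_second_order _ f g).
  - near=> s.
    have ? : is_derive s (1 : R) (fun s => phi (s *: v + z)) ('D_v phi (s *: v + z)).
      apply: is_derive_line; apply: diff_derivable; apply: dphi.
      by near: s.
    exact: is_deriveZ.
  - have ? : is_derive (0 : R) (1 : R) (fun s => 'D_v phi (s *: v + z)) ('D_v ('D_v phi) z).
      rewrite -{2}line0; apply: is_derive_line; rewrite line0.
      by apply: diff_derivable; have [+ _] := dDphi v; apply.
    exact: is_deriveZ.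
  - near=> s; rewrite /f line0; apply: contact.
    by near: s.
by split=> //; move: g0; rewrite /g line0.
Unshelve. all: by end_near. Qed.

(** * Horizontal derivatives in coordinates *)

Lemma derive_coordinates (R : realType) (phi : spacetime R -> R)
    (z v : spacetime R) :
  differentiable phi z ->
  'D_v phi z = v.1 0 0 * space_partial 0 phi z
    + v.1 0 1 * space_partial 1 phi z + v.1 0 2 * space_partial 2 phi z
    + v.2 * time_partial phi z.
Proof.
move=> dphi; rewrite /space_partial /time_partial !deriveE //.
have {1}-> : v = v.1 0 0 *: (delta_mx 0 0, 0) + v.1 0 1 *: (delta_mx 0 1, 0)
    + v.1 0 2 *: (delta_mx 0 2, 0) + v.2 *: ((0, 1) : spacetime R).
  case: v => p t; congr pair => /=; last first.
    by rewrite /GRing.scale /= !mulr0 !add0r mulr1.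
  apply/rowP => j; rewrite !mxE /=.
  case: j => -[|[|[|//]]] lt3 /=; rewrite ?(mulr0, mulr1, addr0, add0r); congr (p 0 _); exact: val_inj.
by rewrite !linearD !linearZ.
Qed.

Lemma is_derive_coordinate (R : realType) (z v : spacetime R) (j : 'I_3) :
  is_derive z v (fun y : spacetime R => y.1 0 j) (v.1 0 j).
Proof.
have H : h^-1 *: (((fun y : spacetime R => y.1 0 j) \o shift z) (h *: v) - z.1 0 j)
   @[h --> (0 : R)^'] --> v.1 0 j.
  apply: cvg_near_cst; near=> h => /=.
  apply/eqP; rewrite !mxE addrK scalerA mulVf ?scale1r //.
  by near: h; exact: nbhs_dnbhs_neq.
by split; [exact: (cvgP _ H) | exact: cvg_lim H].
Unshelve. all: by end_near. Qed.

(** Product rule: the last term comes from the variable coefficient of [X1]. Such first-order terms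
    have opposite signs in $X_1X_2$ and $X_2X_1$, so they cancel in the symmetrized Hessian. *)
Lemma derive_X1 (R : realType) (phi : spacetime R -> R) (z v : spacetime R) :
  derivable (space_partial 0 phi) z v -> derivable (space_partial 2 phi) z v ->
  'D_v (X1 phi) z = 'D_v (space_partial 0 phi) z
    - (z.1 0 1 / 2 * 'D_v (space_partial 2 phi) z
       + v.1 0 1 / 2 * space_partial 2 phi z).
Proof.
move=> /derivableP d0 /derivableP d2.
have dc := is_derive_coordinate _ z v 1.
have -> : X1 phi = space_partial 0 phi
    - (2^-1 \*: (fun y : spacetime R => y.1 0 1)) * space_partial 2 phi.
  by apply/funext => y; rewrite /X1 !fctE; congr (_ - _ * _); exact: mulrC.
have [_ ->] := is_deriveB d0 (is_deriveM (is_deriveZ 2^-1 dc) d2).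
congr (_ - (_ * _ + _)); first exact: mulrC.
by rewrite [RHS]mulrC (mulrC (v.1 0 1)).
Qed.

Lemma derive_X2 (R : realType) (phi : spacetime R -> R) (z v : spacetime R) :
  derivable (space_partial 1 phi) z v -> derivable (space_partial 2 phi) z v ->
  'D_v (X2 phi) z = 'D_v (space_partial 1 phi) z
    + (z.1 0 0 / 2 * 'D_v (space_partial 2 phi) z
       + v.1 0 0 / 2 * space_partial 2 phi z).
Proof.
move=> /derivableP d1 /derivableP d2.
have dc := is_derive_coordinate _ z v 0.
have -> : X2 phi = space_partial 1 phi
    + (2^-1 \*: (fun y : spacetime R => y.1 0 0)) * space_partial 2 phi.
  by apply/funext => y; rewrite /X2 !fctE; congr (_ + _ * _); exact: mulrC.
have [_ ->] := is_deriveD d1 (is_deriveM (is_deriveZ 2^-1 dc) d2).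
congr (_ + (_ * _ + _)); first exact: mulrC.
by rewrite [RHS]mulrC (mulrC (v.1 0 0)).
Qed.

(* The integral curve of [a X1 + b X2] through [z] is a straight line with
   this velocity. *)
Definition horizontal_direction {R : realType} (z : spacetime R) (a b : R) :
    spacetime R :=
  (a *: delta_mx 0 0 + b *: delta_mx 0 1
   + ((b * z.1 0 0 - a * z.1 0 1) / 2) *: delta_mx 0 2, 0).

Definition quadratic_value {R : realType} (Y : 'M[R]_2) (a b : R) : R :=
  a ^+ 2 * Y 0 0 + a * b * (Y 0 1 + Y 1 0) + b ^+ 2 * Y 1 1.

Lemma derive2_horizontal (R : realType) (O : set (spacetime R))
    (phi : spacetime R -> R) (z : spacetime R) (a b : R) :
  open O -> smooth_on O phi -> O z ->
  let v := horizontal_direction z a b in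
  'D_v ('D_v phi) z = quadratic_value (sym_horizontal_hessian phi z) a b.
Proof.
move=> oO sphi Oz v.
have v2 : v.2 = 0 by [].
have [va vb vc] : [/\ v.1 0 0 = a, v.1 0 1 = b &
    v.1 0 2 = (b * z.1 0 0 - a * z.1 0 1) / 2].
  by rewrite !mxE /= ?(mulr0, mulr1, addr0, add0r).
clearbody v; have [dphi dD] := sphi 2.
have dDz w : differentiable ('D_w phi) z by have [+ _] := dD w; apply.
have dP w i : derivable (space_partial i phi) z w.
  by apply: diff_derivable; exact: dDz.
have -> : 'D_v ('D_v phi) z = v.1 0 0 * 'D_v (space_partial 0 phi) z
    + v.1 0 1 * 'D_v (space_partial 1 phi) z
    + v.1 0 2 * 'D_v (space_partial 2 phi) z + v.2 * 'D_v (time_partial phi) z.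
  have Z c w : is_derive z v (c \*: 'D_w phi) (c *: 'D_v ('D_w phi) z).
    by apply: is_deriveZ; apply: derivableP; apply: diff_derivable.
  have [_ <-] := is_deriveD (is_deriveD (is_deriveD
    (Z (v.1 0 0) (delta_mx 0 0, 0)) (Z (v.1 0 1) (delta_mx 0 1, 0)))
    (Z (v.1 0 2) (delta_mx 0 2, 0))) (Z v.2 (0, 1)).
  (* The coordinate expansion of ['D_v phi] is available only on [O]; since [O] is open, that
     suffices to differentiate it at [z]. *)
  apply: near_eq_derive; near=> y; apply: derive_coordinates; apply: dphi.
  by near: y; exact: open_nbhs_nbhs.
have C i : 'D_v (space_partial i phi) z =
    v.1 0 0 * space_partial 0 (space_partial i phi) z
    + v.1 0 1 * space_partial 1 (space_partial i phi) z
    + v.1 0 2 * space_partial 2 (space_partial i phi) z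
    + v.2 * time_partial (space_partial i phi) z.
  by apply: derive_coordinates; exact: dDz.
have E1 i : space_partial i (X1 phi) z = space_partial i (space_partial 0 phi) z
    - (z.1 0 1 / 2 * space_partial i (space_partial 2 phi) z
       + (1 == i)%:R / 2 * space_partial 2 phi z).
  have := derive_X1 _ phi z (delta_mx 0 i, 0) (dP _ _) (dP _ _).
  by rewrite mxE eqxx.
have E2 i : space_partial i (X2 phi) z = space_partial i (space_partial 1 phi) z
    + (z.1 0 0 / 2 * space_partial i (space_partial 2 phi) z
       + (0 == i)%:R / 2 * space_partial 2 phi z).
  have := derive_X2 _ phi z (delta_mx 0 i, 0) (dP _ _) (dP _ _).
  by rewrite mxE eqxx.
rewrite /quadratic_value !mxE.
have -> : horizontal_field (R := R) 0 = @X1 R by [].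
have -> : horizontal_field (R := R) 1 = @X2 R by [].
have XE1 u : X1 u z = space_partial 0 u z - z.1 0 1 / 2 * space_partial 2 u z by [].
have XE2 u : X2 u z = space_partial 1 u z + z.1 0 0 / 2 * space_partial 2 u z by [].
rewrite v2 mul0r addr0.
(* With the operators abstracted, rewriting cannot unfold the derivatives. *)
move: C E1 E2 XE1 XE2; rewrite v2 va vb vc.
move: (@space_partial R) (@X1 R) (@X2 R) => P Y1 Y2 C E1 E2 XE1 XE2.
rewrite !C.
rewrite !XE1 !XE2 !E1 !E2 /=.
by field.
Unshelve. all: by end_near. Qed.

(** * The explicit flow restricted to lines *)

(** Encoding the restriction to a line as a polynomial turns its derivatives into formal ones,
    computed by rewriting. *)
Definition flow_along {R : realType} (z v : spacetime R) : {poly R} :=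
  let c j := (z.1 0 j)%:P + v.1 0 j *: 'X in
  let t := z.2%:P + v.2 *: 'X in
  let r2 := c 0 * c 0 + c 1 * c 1 in
  r2 * r2 + 12 *: (t * r2) + 16 *: (c 2 * c 2) + 12 *: (t * t).

Lemma flow_alongE (R : realType) (z v : spacetime R) (s : R) :
  (flow_along z v).[s] = explicit_flow (s *: v + z).
Proof.
case: z => p t; rewrite /flow_along /explicit_flow /= !hornerE !mxE.
by rewrite /GRing.scale /=; ring.
Qed.

Definition flow_speed {R : realType} (z : spacetime R) : R :=
  12 * (z.1 0 0 ^+ 2 + z.1 0 1 ^+ 2) + 24 * z.2.

Lemma flow_along_time (R : realType) (z : spacetime R) :
  (flow_along z (0, 1))^`().[0] = flow_speed z.
Proof.
rewrite /flow_along /flow_speed /= !mxE.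
move: (z.1 0 0) (z.1 0 1) (z.1 0 2) z.2 => x y w t.
rewrite !scale0r !addr0 !poly.derivE /= !(mul0r, mulr0, addr0, add0r).
rewrite !(hornerD, hornerM, hornerZ, hornerX, hornerC).
by ring.
Qed.

(** With $r^2=x^2+y^2$, the quartic term contributes $8(ax+by)^2+4r^2(a^2+b^2)$ and the vertical
    term $32((bx-ay)/2)^2=8(bx-ay)^2$. The weight 16 makes the two squares add up to
    $8r^2(a^2+b^2)$, so the form is isotropic. *)
Lemma flow_along_horizontal (R : realType) (z : spacetime R) (a b : R) :
  (flow_along z (horizontal_direction z a b))^`()^`().[0] =
  flow_speed z * (a ^+ 2 + b ^+ 2).
Proof.
rewrite /flow_along /flow_speed /= !mxE /= ?(mulr0, mulr1, addr0, add0r).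
move: (z.1 0 0) (z.1 0 1) (z.1 0 2) z.2 => x y w t.
rewrite scale0r addr0 !poly.derivE /= !(mul0r, mulr0, addr0, add0r).
rewrite !(hornerD, hornerM, hornerZ, hornerX, hornerC).
by field.
Qed.

(** * Bounds on the envelopes of the operator *)

(** In dimension two the projection orthogonal to [eta] has rank one, spanned by
    [(- eta 0 1, eta 0 0)]. The squares are ordered to match $a^2+b^2$ at that vector. *)
Lemma mcf_operatorE (R : realType) (eta : 'rV[R]_2) (Y : 'M[R]_2) :
  eta != 0 ->
  mcf_operator eta Y = - (quadratic_value Y (- eta 0 1) (eta 0 0)
                          / (eta 0 1 ^+ 2 + eta 0 0 ^+ 2)) /\
  0 < eta 0 1 ^+ 2 + eta 0 0 ^+ 2.
Proof.
move=> eta0.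
have n0 : 0 < eta 0 1 ^+ 2 + eta 0 0 ^+ 2.
  rewrite lt_neqAle addr_ge0 ?sqr_ge0 // andbT eq_sym paddr_eq0 ?sqr_ge0 //.
  rewrite !sqrf_eq0; apply: contra eta0 => /andP[/eqP e1 /eqP e0].
  apply/eqP/rowP => -[[|[|//]] lt2]; rewrite mxE.
    by rewrite -[RHS]e0; congr (eta _ _); exact: val_inj.
  by rewrite -[RHS]e1; congr (eta _ _); exact: val_inj.
split=> //.
rewrite /mcf_operator /quadratic_value /mxtrace !big_ord_recl big_ord0.
rewrite !mxE !big_ord_recl !big_ord0 !mxE !big_ord_recl !big_ord0 !mxE.
have -> : lift ord0 ord0 = 1 :> 'I_2 by exact: val_inj.
have -> : ord0 = 0 :> 'I_2 by [].
have -> : ord0 = 0 :> 'I_1 by [].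
by rewrite /=; field; rewrite gt_eqF.
Qed.

(* No continuity of the operator is needed: it suffices to bound it at nearby
   points with the same matrix, which lie in its domain even if [eta = 0]. *)
Lemma mcf_domain_dense (R : realType) (eta : 'rV[R]_2) (Y : 'M[R]_2)
    (A : set ('rV[R]_2 * 'M[R]_2)) :
  Y^T = Y -> within (@mcf_domain R) (nbhs (eta, Y)) A ->
  exists2 eta', eta' != 0 & A (eta', Y).
Proof.
move=> symY; rewrite /within /= => nA.
have [eta0|eta0] := eqVneq eta 0; last first.
  by exists eta => //; apply: (nbhs_singleton nA).
(* A vanishing [eta] is approached along the first axis by nonzero multiples of a basis vector. *)
have cvg_eta : (fun h : R => h *: delta_mx 0 0 : 'rV[R]_2) @ (0 : R)^' --> eta.
  have -> : eta = (0 : R) *: delta_mx 0 0 by rewrite eta0 scale0r.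
  by apply: cvg_within_filter; apply: cvgZ; [exact: cvg_id | exact: cvg_cst].
have cvg_Y : (fun=> Y) @ (0 : R)^' --> Y by exact: cvg_cst.
have nA' : \forall h \near (0 : R)^',
    mcf_domain (h *: delta_mx 0 0, Y) -> A (h *: delta_mx 0 0, Y).
  exact: (cvg_pair cvg_eta cvg_Y nA).
have h0 : \forall h \near (0 : R)^', h != 0 by exact: nbhs_dnbhs_neq.
have [h [hA hn0]] := filter_ex (filterI nA' h0).
have d0 : h *: delta_mx 0 0 != 0 :> 'rV[R]_2.
  rewrite scaler_eq0 negb_or hn0; apply/eqP => /matrixP/(_ 0 0)/eqP.
  by rewrite !mxE oner_eq0.
by exists (h *: delta_mx 0 0) => //; apply: hA.
Qed.

(** The lower limit is a supremum of infima over the sets of the filter, so one point with value at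
    most [- C] in each set is enough; [mcf_domain_dense] supplies it with the same matrix [Y]. *)
Lemma mcf_lower_envelope_le (R : realType) (eta : 'rV[R]_2) (Y : 'M[R]_2) (C : R) :
  Y^T = Y ->
  (forall a b, C * (a ^+ 2 + b ^+ 2) <= quadratic_value Y a b) ->
  (mcf_lower_envelope eta Y <= (- C)%:E)%E.
Proof.
move=> symY CY; rewrite /mcf_lower_envelope limf_einfE.
apply: ge_ereal_sup => _ [A /(mcf_domain_dense _ _ _ _ symY)[eta' eta'0 Aeta'] <-].
apply: (@le_trans _ _ (mcf_operator eta' Y)%:E).
  by apply: ereal_inf_lbound; exists (eta', Y).
have [-> n0] := mcf_operatorE _ eta' Y eta'0.
rewrite lee_fin lerN2 ler_pdivlMr //.
by have := CY (- eta' 0 1) (eta' 0 0); rewrite sqrrN.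
Qed.

Lemma mcf_upper_envelope_ge (R : realType) (eta : 'rV[R]_2) (Y : 'M[R]_2) (C : R) :
  Y^T = Y ->
  (forall a b, quadratic_value Y a b <= C * (a ^+ 2 + b ^+ 2)) ->
  ((- C)%:E <= mcf_upper_envelope eta Y)%E.
Proof.
move=> symY CY; rewrite /mcf_upper_envelope limf_esupE.
apply: le_ereal_inf_tmp => _ [A /(mcf_domain_dense _ _ _ _ symY)[eta' eta'0 Aeta'] <-].
apply: (@le_trans _ _ (mcf_operator eta' Y)%:E); last first.
  by apply: ereal_sup_ubound; exists (eta', Y).
have [-> n0] := mcf_operatorE _ eta' Y eta'0.
rewrite lee_fin lerN2 ler_pdivrMr //.
by have := CY (- eta' 0 1) (eta' 0 0); rewrite sqrrN.
Qed.

(** * Test functions touching the flow, and the conclusion *)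

Lemma open_upper_half (R : realType) : open [set z : spacetime R | 0 < z.2].
Proof.
have ct : continuous (fun z : spacetime R => z.2) by move=> z; exact: cvg_snd.
by move/continuousP: ct => /(_ _ (@open_gt R 0)).
Qed.

(** The time axis gives the first-order identity, an equality because the half-space is open and
    time may move both ways. Horizontal lines, along which time is constant, give the second-order
    inequality. *)
Lemma flow_contact (R : realType) (phi : spacetime R -> R) (z : spacetime R)
    (e : R) :
  e != 0 -> smooth_on [set y : spacetime R | 0 < y.2] phi -> 0 < z.2 ->
  (forall y, 0 < y.2 ->
     e * (phi z - explicit_flow z) <= e * (phi y - explicit_flow y)) ->
  time_partial phi z = flow_speed z /\
  forall a b, 0 <= e * (quadratic_value (sym_horizontal_hessian phi z) a b
                        - flow_speed z * (a ^+ 2 + b ^+ 2)).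
Proof.
move=> e0 sphi z0 contact.
have line v := line_contact _ _ _ phi z v (flow_along z v) e (open_upper_half R) sphi z0.
have {contact} {}line v : e * ('D_v phi z - (flow_along z v)^`().[0]) = 0 /\
    0 <= e * ('D_v ('D_v phi) z - (flow_along z v)^`()^`().[0]).
  apply: line => s sO; rewrite !flow_alongE scale0r add0r; exact: contact.
split=> [|a b].
  have [/eqP + _] := line (0, 1).
  by rewrite mulf_eq0 (negbTE e0) flow_along_time subr_eq0 => /eqP.
have [_] := line (horizontal_direction z a b).
rewrite flow_along_horizontal.
by rewrite (derive2_horizontal _ _ _ _ _ _ (open_upper_half R) sphi z0).
Qed.

Lemma sym_horizontal_hessian_tr (R : realType) (phi : spacetime R -> R)
    (z : spacetime R) :
  (sym_horizontal_hessian phi z)^T = sym_horizontal_hessian phi z.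
Proof. by apply/matrixP => i j; rewrite !mxE addrC. Qed.

Lemma continuous_explicit_flow (R : realType) : continuous (@explicit_flow R).
Proof.
have cc (j : 'I_3) : continuous (fun z : spacetime R => z.1 0 j).
  move=> z; apply: (@cvg_comp _ _ _ fst (fun p : 'rV[R]_3 => p 0 j)).
    exact: cvg_fst.
  exact: coord_continuous.
have ct : continuous (fun z : spacetime R => z.2) by move=> z; exact: cvg_snd.
have -> : @explicit_flow R = fun z : spacetime R => 
  (z.1 0 0 * z.1 0 0 + z.1 0 1 * z.1 0 1) * (z.1 0 0 * z.1 0 0 + z.1 0 1 * z.1 0 1)
   + 12 * z.2 * (z.1 0 0 * z.1 0 0 + z.1 0 1 * z.1 0 1)
  + 16 * (z.1 0 2 * z.1 0 2) + 12 * (z.2 * z.2).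
  by apply/funext => -[p t]; rewrite /explicit_flow !expr2.
move=> z.
have cr : {for z, continuous
    (fun z : spacetime R => z.1 0 0 * z.1 0 0 + z.1 0 1 * z.1 0 1)}.
  by apply: cvgD; apply: cvgM; exact: cc.
apply: cvgD; last by apply: cvgM; [exact: cvg_cst | apply: cvgM; exact: ct].
apply: cvgD; last by apply: cvgM; [exact: cvg_cst | apply: cvgM; exact: cc].
apply: cvgD; first by apply: cvgM; exact: cr.
by apply: cvgM; [apply: cvgM; [exact: cvg_cst | exact: ct] | exact: cr].
Qed.

Theorem proposition3p2 (R : realType) :
  [/\ {within [set z : spacetime R | 0 <= z.2], continuous (@explicit_flow R)},
      viscosity_solution [set z : spacetime R | 0 < z.2]
                         (fun z => (explicit_flow z)%:E)
    & forall p : heisenberg R, explicit_flow (p, 0) = gauge4 p].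
Proof.
(* Used on the closed half-space for continuity up to time zero and on the open one for both
   semicontinuities. *)
have wc A : {within A, continuous (@explicit_flow R)}.
  exact/continuous_subspaceT/continuous_explicit_flow.
split; [exact: wc | split | by move=> p; rewrite /explicit_flow /gauge4; ring].
  split=> [z a|z _|phi z sphi z0 _ touch]; rewrite ?ltry //.
    rewrite lte_fin => za; have := cvgr_lt _ (wc _ z) _ za.
    by move=> V; exists [set y | explicit_flow y < a] => [|y]; [exact: V | rewrite lte_fin].
  (* A maximum of the flow minus [phi] is a minimum of [phi] minus the flow, hence the sign [1]; the
     supersolution case takes [-1]. *)
  have [|y y0|-> hess] := flow_contact R phi z 1 _ sphi z0.
  - exact: oner_neq0.
  - by have := touch y y0; rewrite -!EFinB lee_fin; lra.
  apply: (@le_trans _ _ ((flow_speed z)%:E + (- flow_speed z)%:E)%E).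
    rewrite leeD2l //; apply: mcf_lower_envelope_le => [|a b].
      exact: sym_horizontal_hessian_tr.
    by have := hess a b; lra.
  by rewrite -EFinD subrr.
split=> [z a|z _|phi z sphi z0 _ touch]; rewrite ?ltNyr //.
  rewrite lte_fin => za; have := cvgr_gt _ (wc _ z) _ za.
  by move=> V; exists [set y | a < explicit_flow y] => [|y]; [exact: V | rewrite lte_fin].
have [|y y0|-> hess] := flow_contact R phi z (-1) _ sphi z0.
- by rewrite oppr_eq0 oner_neq0.
- by have := touch y y0; rewrite -!EFinB lee_fin; lra.
apply: (@le_trans _ _ ((flow_speed z)%:E + (- flow_speed z)%:E)%E).
  by rewrite -EFinD subrr.
rewrite leeD2l //; apply: mcf_upper_envelope_ge => [|a b].
  exact: sym_horizontal_hessian_tr.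
by have := hess a b; lra.
Qed.
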